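(* For any integer $N \ge 3$ and any $\varepsilon > 0$, there exist a tensor $\mathcal{X} \in \mathbb{R}^{I_1 \times \cdots \times I_N}$ and a multilinear rank $\mathbf{r} = (R_1,\dots,R_N)$ such that \[ \left\| \mathcal{X} - \widehat{\mathcal{X}}_{\mathrm{ST\text{-}HOSVD}(\mathbf{r})} \right\|_F^2 \;\ge\; \frac{N}{1+\varepsilon}\, L(\mathcal{X}, \mathbf{r}). \]
   Context: For a tensor $\mathcal{X} \in \mathbb{R}^{I_1 \times \cdots \times I_N}$, the mode-$n$ unfolding $\mathbf{X}_{(n)}$ is the matrix with $I_n$ rows whose columns are the mode-$n$ fibers of $\mathcal{X}$ (vectors obtained by fixing all indices except the $n$-th), ordered lexicographically. The mode-$n$ product of $\mathcal{X}$ with $\mathbf{U} \in \mathbb{R}^{J \times I_n}$ is the tensor $\mathcal{X} \times_n \mathbf{U}$ with entries $(\mathcal{X}\times_n \mathbf{U})_{i_1\dots i_{n-1} j i_{n+1}\dots i_N} = \sum_{i_n=1}^{I_n} x_{i_1\dots i_N} u_{j i_n}$. For a multilinear rank $\mathbf{r}=(R_1,\dots,R_N)$ with $R_n \le I_n$, define \[ L(\mathcal{X},\mathbf{r}) = \min \left\| \mathcal{X} - \mathcal{G} \times_1 \mathbf{A}^{(1)} \times_2 \cdots \times_N \mathbf{A}^{(N)} \right\|_F^2 \] over all $\mathcal{G} \in \mathbb{R}^{R_1\times\cdots\times R_N}$ and $\mathbf{A}^{(n)} \in \mathbb{R}^{I_n \times R_n}$. The sequentially truncated HOSVD (ST-HOSVD),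 processing modes in the order $1,2,\dots,N$: set $\mathcal{X}^{(1)} = \mathcal{X}$; for $n = 1,\dots,N$, let $\mathbf{A}^{(n)}$ be the matrix whose columns are left singular vectors of the mode-$n$ unfolding $\mathbf{X}^{(n)}_{(n)}$ of $\mathcal{X}^{(n)}$ corresponding to its $R_n$ largest singular values (computed by a fixed deterministic SVD routine; when $\mathbf{X}^{(n)}_{(n)}\mathbf{X}^{(n)\top}_{(n)}$ is diagonal the returned left singular vectors are standard basis vectors), and set $\mathcal{X}^{(n+1)} = \mathcal{X}^{(n)} \times_n \mathbf{A}^{(n)\top}$. Finally $\mathcal{G} = \mathcal{X} \times_1 \mathbf{A}^{(1)\top} \times_2 \cdots \times_N \mathbf{A}^{(N)\top}$ and $\widehat{\mathcal{X}}_{\mathrm{ST\text{-}HOSVD}(\mathbf{r})} = \mathcal{G} \times_1 \mathbf{A}^{(1)} \times_2 \cdots \times_N \mathbf{A}^{(N)}$. *)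

(* Defs.v *)
From HB Require Import structures.
From mathcomp Require Import all_boot all_order all_algebra.
From mathcomp Require Import reals.

Set Implicit Arguments.
Unset Strict Implicit.
Unset Printing Implicit Defensive.

Import Order.TTheory GRing.Theory Num.Theory.
Local Open Scope ring_scope.

(** Modes and indices are numbered from 0, so an order-[N] tensor has its modes
    in ['I_N] and its dimensions are given by [d : 'I_N -> nat]. *)

Definition multi_index (N : nat) (d : 'I_N -> nat) : finType :=
  {dffun forall m : 'I_N, 'I_(d m)}.

Definition tensor (R : Type) (N : nat) (d : 'I_N -> nat) : Type :=
  {ffun multi_index d -> R}.

Definition frob_sq (R : realType) (N : nat) (d : 'I_N -> nat)
    (X : tensor R d) : R :=
  \sum_(i : multi_index d) X i ^+ 2.

Definition agree_off (N : nat) (d d' : 'I_N -> nat) (n : 'I_N)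
    (i : multi_index d) (i' : multi_index d') : bool :=
  [forall m : 'I_N, (m != n) ==> (val (i m) == val (i' m))].

(** The mode-[n] product of [X] with [U], to be used when [d'] and [d] coincide
    at every mode other than [n].  The multi-indices [i] that agree with [i']
    off mode [n] are then exactly the [d n] multi-indices obtained from [i'] by
    replacing its [n]-th component. *)
Definition mode_prod (R : realType) (N : nat) (d d' : 'I_N -> nat) (n : 'I_N)
    (X : tensor R d) (U : 'M[R]_(d' n, d n)) : tensor R d' :=
  [ffun i' : multi_index d' =>
     \sum_(i : multi_index d | agree_off n i i') X i * U (i' n) (i n)].

(** Position of the mode-[n] fiber through [i] in the lexicographic order of the
    indices [(i_m)_(m != n)], the lowest mode being the most significant. *)
Definition fiber_rank (N : nat) (d : 'I_N -> nat) (n : 'I_N)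
    (i : multi_index d) : nat :=
  (\sum_(m < N | m != n) i m * \prod_(k < N | (k != n) && (m < k)) d k)%N.

(** The entry of [X] at [i] is put in row [i n] and column [fiber_rank n i]; as
    [fiber_rank n] numbers the fibers bijectively, each sum has one term. *)
Definition unfolding (R : realType) (N : nat) (d : 'I_N -> nat) (n : 'I_N)
    (X : tensor R d) : 'M[R]_(d n, (\prod_(m < N | m != n) d m)%N) :=
  \matrix_(a, c)
    \sum_(i : multi_index d | (i n == a) && (fiber_rank n i == c :> nat)) X i.

(** Dimensions once the modes [0, ..., k - 1] have been changed from [I] to [J]. *)
Definition stage (N : nat) (I J : 'I_N -> nat) (k : nat) : 'I_N -> nat :=
  fun m => if (m < k)%N then J m else I m.

Lemma stage_cur (N : nat) (I J : 'I_N -> nat) (n : 'I_N) :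
  stage I J n n = I n.
Proof. by rewrite /stage ltnn. Qed.

Lemma stage_next (N : nat) (I J : 'I_N -> nat) (n : 'I_N) :
  stage I J n.+1 n = J n.
Proof. by rewrite /stage ltnSn. Qed.

Lemma stage_end (N : nat) (I J : 'I_N -> nat) (m : 'I_N) :
  stage I J N m = J m.
Proof. by rewrite /stage ltn_ord. Qed.

Definition cast_tensor (R : Type) (N : nat) (d d' : 'I_N -> nat)
    (e : forall m, d' m = d m) (X : tensor R d) : tensor R d' :=
  [ffun i' : multi_index d' =>
     X ([ffun m => cast_ord (e m) (i' m)] : multi_index d)].

Definition stage_prod (R : realType) (N : nat) (I J : 'I_N -> nat) (n : 'I_N)
    (Y : tensor R (stage I J n)) (U : 'M[R]_(J n, I n)) :
    tensor R (stage I J n.+1) :=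
  mode_prod Y (castmx (esym (stage_next I J n), esym (stage_cur I J n)) U).

Fixpoint partial_multi_prod (R : realType) (N : nat) (I J : 'I_N -> nat)
    (X : tensor R I) (U : forall n : 'I_N, 'M[R]_(J n, I n)) (k : nat) :
    (k <= N)%N -> tensor R (stage I J k) :=
  match k return (k <= N)%N -> tensor R (stage I J k) with
  | 0 => fun _ => X
  | k'.+1 => fun hk =>
      @stage_prod R N I J (Ordinal hk)
        (partial_multi_prod X U (ltnW hk)) (U (Ordinal hk))
  end.

(** [X x_1 U_1 x_2 ... x_N U_N] *)
Definition multi_prod (R : realType) (N : nat) (I J : 'I_N -> nat)
    (X : tensor R I) (U : forall n : 'I_N, 'M[R]_(J n, I n)) : tensor R J :=
  cast_tensor (fun m => esym (stage_end I J m))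
    (partial_multi_prod X U (leqnn N)).

(** [L = L(X, r)] *)
Definition is_tucker_min (R : realType) (N : nat) (I r : 'I_N -> nat)
    (X : tensor R I) (L : R) : Prop :=
  (exists (G : tensor R r) (A : forall n : 'I_N, 'M[R]_(I n, r n)),
      frob_sq (X - multi_prod G A) = L) /\
  (forall (G : tensor R r) (A : forall n : 'I_N, 'M[R]_(I n, r n)),
      L <= frob_sq (X - multi_prod G A)).

Definition is_svd (R : realType) (m p : nat) (M : 'M[R]_(m, p))
    (U : 'M[R]_m) (D : 'M[R]_(m, p)) (V : 'M[R]_p) : Prop :=
  [/\ U^T *m U = 1%:M, V^T *m V = 1%:M, M = U *m D *m V^T,
      forall (i : 'I_m) (j : 'I_p), i != j :> nat -> D i j = 0
    & (forall (i : 'I_m) (j : 'I_p), i = j :> nat -> 0 <= D i j) /\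
      (forall (i i' : 'I_m) (j j' : 'I_p),
         i = j :> nat -> i' = j' :> nat -> (i <= i')%N -> D i' j' <= D i j)].

Definition svd_routine (R : realType) : Type :=
  forall m p : nat, 'M[R]_(m, p) -> 'M[R]_m * 'M[R]_(m, p) * 'M[R]_p.

Definition is_svd_routine (R : realType) (svd : svd_routine R) : Prop :=
  forall (m p : nat) (M : 'M[R]_(m, p)),
    let: (U, D, V) := svd m p M in
    is_svd M U D V /\
    (is_diag_mx (M *m M^T) -> forall j, exists k, col j U = delta_mx k 0).

Definition leading_left_vectors (R : realType) (svd : svd_routine R)
    (m p r : nat) (hr : (r <= m)%N) (M : 'M[R]_(m, p)) : 'M[R]_(m, r) :=
  colsub (widen_ord hr) (svd m p M).1.1.

Section STHOSVD.
Variables (R : realType) (svd : svd_routine R) (N : nat) (I r : 'I_N -> nat).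
Variables (hr : forall n, (r n <= I n)%N) (X : tensor R I).

Definition st_step_factor (n : 'I_N) (Y : tensor R (stage I r n)) :
    'M[R]_(I n, r n) :=
  leading_left_vectors svd (hr n)
    (castmx (stage_cur I r n, erefl) (unfolding n Y)).

(** [st_iterate k _] is the tensor obtained after processing the first [k]
    modes. *)
Fixpoint st_iterate (k : nat) : (k <= N)%N -> tensor R (stage I r k) :=
  match k return (k <= N)%N -> tensor R (stage I r k) with
  | 0 => fun _ => X
  | k'.+1 => fun hk =>
      let Y := st_iterate (ltnW hk) in
      @stage_prod R N I r (Ordinal hk) Y (@st_step_factor (Ordinal hk) Y)^T
  end.

Definition st_factor (n : 'I_N) : 'M[R]_(I n, r n) :=
  st_step_factor (st_iterate (ltnW (ltn_ord n))).

Definition st_core : tensor R r := multi_prod X (fun n => (st_factor n)^T).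

Definition st_hosvd : tensor R I := multi_prod st_core st_factor.

End STHOSVD.

(* Main.v *)
Require Import Defs.
From mathcomp Require Import all_boot all_order all_algebra.
From mathcomp Require Import reals.
From mathcomp Require Import ring lra.
Import Order.TTheory GRing.Theory Num.Theory.
Local Open Scope ring_scope.

Set Implicit Arguments.
Unset Strict Implicit.
Unset Printing Implicit Defensive.

(** All dimensions are 4 and all ranks are 3.  Let X have the entry 1 at (0, ..., 0), and, for
    every mode n, the entry c at the position with n-th index 1 and all others 2, and the
    entry 4 at the position with n-th index 2 and all others 3, where c^2 < 1 is close to 1.
    Two positions of the support always differ in at least two modes, so every unfolding has
    a diagonal Gram matrix, and ST-HOSVD removes the index value of least energy: this is 1,
    of energy c^2, in each mode.  The N lost entries are distinct, so the error is at least
    N c^2.  Removing the index value 0 instead costs 1 in total.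

    This is optimal, so that L = 1.  Any approximation T is annihilated by unit vectors u in
    the first mode and v in the second.  On a slice X_k spanned by these two modes, the
    residual E_k has u E_k = u X_k and E_k v = X_k v, hence
    |E_k|^2 >= |u X_k|^2 + |X_k v|^2 - (u X_k v)^2.  Adding this up over the slices where all
    the other indices are 0, 2 and 3 gives |X - T|^2 >= 1. *)

(** * Entrywise formulas for multilinear products *)

(* Entries at natural-number positions, [0] out of range: they are insensitive to the
   dimension casts in [stage_prod]. *)
Definition mxnat (R : realType) (p q : nat) (U : 'M[R]_(p, q)) (a b : nat) : R :=
  if insub a is Some i then if insub b is Some j then U i j else 0 else 0.

Lemma mxnatE (R : realType) (p q : nat) (U : 'M[R]_(p, q)) (i : 'I_p) (j : 'I_q) :
  mxnat U i j = U i j.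
Proof. by rewrite /mxnat !valK. Qed.

Lemma mxnat_castmx (R : realType) (p q p' q' : nat) (e : (p = p') * (q = q'))
    (U : 'M[R]_(p, q)) : mxnat (castmx e U) = mxnat U.
Proof. by case: e => e1 e2; case: p' / e1; case: q' / e2. Qed.

Lemma multi_index_ext (N : nat) (d : 'I_N -> nat) (i j : multi_index d) :
  (forall m, i m = j m :> nat) -> i = j.
Proof. by move=> ij; apply/ffunP => m; apply/val_inj/ij. Qed.

Lemma multi_index_of_nat (N : nat) (d : 'I_N -> nat) (f : 'I_N -> nat) :
  (forall m, (f m < d m)%N) -> {i : multi_index d | forall m, i m = f m :> nat}.
Proof.
move=> fd; exists ([ffun m => Ordinal (fd m)] : multi_index d) => m.
by rewrite ffunE.
Qed.

(** By induction, with the two sums exchanged. [mxnat] is used because [i' m] ranges over a [stage]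
    dimension, which equals [J m] only propositionally. *)
Lemma partial_multi_prodE (R : realType) (N : nat) (I J : 'I_N -> nat)
    (X : tensor R I) (U : forall n : 'I_N, 'M[R]_(J n, I n)) (k : nat)
    (hk : (k <= N)%N) (i' : multi_index (stage I J k)) :
  partial_multi_prod X U hk i' =
  \sum_(i : multi_index I | [forall m : 'I_N, (k <= m)%N ==> (i m == i' m :> nat)])
    X i * \prod_(m < N | (m < k)%N) mxnat (U m) (i' m) (i m).
Proof.
elim: k hk i' => [|k IHk] hk i' /=.
  rewrite (big_pred1 (i' : multi_index I)) => [|i /=].
    by rewrite big_pred0 ?mulr1 // => m; rewrite ltn0.
  apply/forallP/eqP => [ii'|-> m]; last exact: eqxx.
  by apply: multi_index_ext => m; apply/eqP; have := ii' m.
set n := Ordinal hk.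
transitivity (\sum_(j : multi_index (stage I J k) |
    @agree_off N (stage I J k) (stage I J k.+1) n j i')
  partial_multi_prod X U (ltnW hk) j * mxnat (U n) (i' n) (j n)).
  rewrite /stage_prod /mode_prod ffunE; apply: eq_bigr => j _.
  by rewrite -mxnatE mxnat_castmx.
under [LHS]eq_bigr => j _ do rewrite IHk mulr_suml.
rewrite (exchange_big_dep (fun i : multi_index I =>
  [forall m : 'I_N, (k < m)%N ==> (i m == i' m :> nat)])) /=; last first.
  move=> j i /forallP ji' /forallP ij; apply/forallP => m; apply/implyP => km.
  have /eqP -> := implyP (ij m) (ltnW km).
  by apply: (implyP (ji' m)); rewrite -val_eqE /= gtn_eqF.
apply: eq_bigr => i /forallP ii'.
(* For a given [i], the only intermediate index [j] has the entry of [i] in mode [n] and those of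
   [i'] elsewhere, so the inner sum has one term. *)
have [|j jE] := @multi_index_of_nat N (stage I J k)
  (fun m => if m == n then val (i m) else val (i' m)).
  move=> m; case: eqP => [->|/eqP mn]; first by rewrite /stage ltnn ltn_ord.
  have -> : stage I J k m = stage I J k.+1 m by
    rewrite /stage ltnS [(m <= k)%N]leq_eqVlt; move: mn; rewrite -val_eqE /= => /negPf ->.
  exact: ltn_ord.
rewrite (big_pred1 j) => [|j' /=].
  rewrite -mulrA; congr (_ * _).
  rewrite [RHS](bigD1 n) /= ?ltnSn // mulrC jE eqxx; congr (_ * _).
  apply: eq_big => [m|m mk].
    by rewrite ltnS -val_eqE /= [in RHS]leq_eqVlt; case: ltngtP.
  by rewrite jE -val_eqE /= (ltn_eqF mk).
apply/andP/eqP => [[/forallP ji' /forallP ij]|->].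
  apply: multi_index_ext => m; rewrite jE.
  case: eqP => [->|/eqP mn]; last exact/eqP/(implyP (ji' m)).
  by apply/esym/eqP/(implyP (ij n)).
split; apply/forallP => m; apply/implyP; rewrite /= jE; first by move=> /negPf ->.
have [//|mn km] := eqVneq m n.
by apply: (implyP (ii' m)); rewrite ltn_neqAle km andbT eq_sym -val_eqE in mn *.
Qed.

Lemma multi_prodE (R : realType) (N : nat) (I J : 'I_N -> nat)
    (X : tensor R I) (U : forall n : 'I_N, 'M[R]_(J n, I n)) (i' : multi_index J) :
  multi_prod X U i' = \sum_(i : multi_index I) X i * \prod_(m < N) U m (i' m) (i m).
Proof.
rewrite /multi_prod /cast_tensor ffunE partial_multi_prodE.
apply: eq_big => [i|i _].
  by apply/forallP => m; rewrite leqNgt ltn_ord.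
congr (_ * _); apply: eq_big => [m|m _]; first by rewrite ltn_ord.
by rewrite ffunE mxnatE.
Qed.

(** When each row of the first [k] factors is a standard basis vector, only one index survives in
    the sum, so the product merely relabels [X]. The relabelling [f] acts on natural numbers to
    avoid casts between stages. *)
Lemma partial_multi_prod_select (R : realType) (N : nat) (I J : 'I_N -> nat)
    (X : tensor R I) (U : forall n : 'I_N, 'M[R]_(J n, I n)) (k : nat)
    (hk : (k <= N)%N) (f : 'I_N -> nat -> nat) :
  (forall m : 'I_N, (m < k)%N ->
     forall j a, U m j a = (a == f m j :> nat)%:R) ->
  forall (i' : multi_index (stage I J k)) (i : multi_index I),
  (forall m, i m = (if (m < k)%N then f m (i' m) else i' m) :> nat) ->
  partial_multi_prod X U hk i' = X i.
Proof.
move=> UE i' i iE; rewrite partial_multi_prodE (bigD1 i) /=; last first.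
  by apply/forallP => m; apply/implyP => km; rewrite iE ltnNge km.
have mxE (m : 'I_N) (a : 'I_(I m)) :
    (m < k)%N -> mxnat (U m) (i' m) a = (a == f m (i' m) :> nat)%:R.
  move=> mk; have lt_i' : (i' m < J m)%N.
    by have := ltn_ord (i' m); rewrite [X in (_ < X)%N]/stage mk.
  by rewrite -[val (i' m)]/(val (Ordinal lt_i')) mxnatE UE.
rewrite big1 ?mulr1 => [|m mk]; last by rewrite mxE // iE mk eqxx.
rewrite big1 ?addr0 // => j /andP[/forallP ji' ji].
have [m jm] : exists m, (j m != i m).
  apply/existsP; rewrite -negb_forall; apply: contra ji => /forallP ji.
  by apply/eqP; apply: multi_index_ext => m; have /eqP -> := ji m.
have mk : (m < k)%N.
  rewrite ltnNge; apply: contra jm => km; rewrite -val_eqE /=.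
  by rewrite iE ltnNge km; exact: (implyP (ji' m)).
rewrite (bigD1 m) //= mxE //.
by move: jm; rewrite -val_eqE /= iE mk => /negPf ->; rewrite mul0r mulr0.
Qed.

Lemma st_iterateE (R : realType) (svd : svd_routine R) (N : nat)
    (I r : 'I_N -> nat) (hr : forall n, (r n <= I n)%N) (X : tensor R I)
    (k : nat) (hk : (k <= N)%N) :
  st_iterate svd hr X hk =
  partial_multi_prod X (fun n => (st_factor svd hr X n)^T) hk.
Proof.
elim: k hk => [//|k IHk] hk /=.
rewrite -IHk /st_factor.
(* [st_factor] restarts the iteration with another proof of the same bound; the two proofs are
   identified here. *)
by rewrite (bool_irrelevance (ltnW (ltn_ord (Ordinal hk))) (ltnW hk)).
Qed.

(** * Numbering of the fibers, and Gram matrices of unfoldings *)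

Definition mixed_radix (N : nat) (x d : 'I_N -> nat) : nat :=
  (\sum_(m < N) x m * \prod_(k < N | m < k) d k)%N.

Lemma mixed_radixS (N : nat) (x d : 'I_N.+1 -> nat) :
  mixed_radix x d =
  (mixed_radix (fun m => x (widen_ord (leqnSn N) m))
     (fun m => d (widen_ord (leqnSn N) m)) * d ord_max + x ord_max)%N.
Proof.
rewrite /mixed_radix big_ord_recr /= big_distrl /=; congr (_ + _)%N.
  apply: eq_bigr => m _; rewrite big_mkcond big_ord_recr /= ltn_ord mulnA.
  by rewrite -big_mkcond.
rewrite big_pred0 ?muln1 // => k; apply/negbTE.
by rewrite -leqNgt -ltnS ltn_ord.
Qed.

Lemma mixed_radix_bound (N : nat) (x d : 'I_N -> nat) :
  (forall m, x m < d m)%N -> (mixed_radix x d < \prod_(m < N) d m)%N.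
Proof.
elim: N x d => [|N IHN] x d xd; first by rewrite /mixed_radix !big_ord0.
rewrite mixed_radixS big_ord_recr /=.
have := IHN _ (fun m => d (widen_ord (leqnSn N) m)) (fun m => xd _).
set S := mixed_radix _ _; set P := (\prod_(m < N) _)%N => SP.
apply: (@leq_trans (S.+1 * d ord_max)); last by rewrite leq_mul2r SP orbT.
by rewrite mulSn addnC ltn_add2r.
Qed.

(** The last digit is the residue modulo the last base; removing it leaves a shorter numeral. *)
Lemma mixed_radix_inj (N : nat) (x y d : 'I_N -> nat) :
  (forall m, x m < d m)%N -> (forall m, y m < d m)%N ->
  mixed_radix x d = mixed_radix y d -> forall m, x m = y m.
Proof.
elim: N x y d => [|N IHN] x y d xd yd; first by move=> _ [].
rewrite !mixed_radixS => E.
have d_gt0 : (0 < d ord_max)%N by apply: leq_ltn_trans (xd ord_max).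
have Emax : x ord_max = y ord_max.
  by have := congr1 (modn^~ (d ord_max)) E; rewrite /= !modnMDl !modn_small.
move/eqP: E; rewrite Emax eqn_add2r eqn_pmul2r // => /eqP E m.
have [j ->|->] := unliftP ord_max m; last exact: Emax.
have := IHN _ _ _ (fun m => xd _) (fun m => yd _) E j.
by have -> : widen_ord (leqnSn N) j = lift ord_max j by
  apply: val_inj; apply: esym (lift_max j).
Qed.

(** Giving mode [n] the base 1 and the digit 0 removes it from the numeral, so results on all modes
    apply. *)
Lemma fiber_rankE (N : nat) (d : 'I_N -> nat) (n : 'I_N) (i : multi_index d) :
  fiber_rank n i = mixed_radix (fun m => if m == n then 0%N else i m)
                               (fun m => if m == n then 1%N else d m).
Proof.
rewrite /fiber_rank /mixed_radix big_mkcond; apply: eq_bigr => m _.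
case: eqP => //= _; congr (_ * _)%N.
by rewrite big_mkcondl; apply: eq_bigr => k _; case: eqP.
Qed.

Lemma fiber_rank_bound (N : nat) (d : 'I_N -> nat) (n : 'I_N)
    (i : multi_index d) : (fiber_rank n i < \prod_(m < N | m != n) d m)%N.
Proof.
rewrite fiber_rankE [X in (_ < X)%N]big_mkcond /=.
rewrite (eq_bigr (fun m => if m == n then 1%N else d m)) => [|m _]; last by case: eqP.
by apply: mixed_radix_bound => m; case: eqP.
Qed.

Lemma fiber_rank_eq (N : nat) (d : 'I_N -> nat) (n : 'I_N)
    (i j : multi_index d) : (fiber_rank n i == fiber_rank n j) = agree_off n i j.
Proof.
apply/eqP/forallP => [|ij]; last first.
  apply: eq_bigr => m mn; congr (_ * _)%N; exact/eqP/(implyP (ij m)).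
rewrite !fiber_rankE => /mixed_radix_inj E m; apply/implyP => /negPf mn.
by apply/eqP; have := fun hi hj => E hi hj m; rewrite mn; apply => k; case: eqP.
Qed.

(** Two entries share a column exactly when their indices agree off mode [n], and each index lies in
    exactly one column, so the sum over columns collapses. *)
Lemma unfolding_gram (R : realType) (N : nat) (d : 'I_N -> nat) (n : 'I_N)
    (Y : tensor R d) (a b : 'I_(d n)) :
  (unfolding n Y *m (unfolding n Y)^T) a b =
  \sum_(i : multi_index d | i n == a) \sum_(j : multi_index d | (j n == b) && agree_off n i j) Y i * Y j.
Proof.
rewrite mxE.
transitivity (\sum_(c < \prod_(m < N | m != n) d m)
  \sum_(i : multi_index d | (i n == a) && (fiber_rank n i == c :> nat))
  \sum_(j : multi_index d | (j n == b) && agree_off n i j) Y i * Y j).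
  apply: eq_bigr => c _; rewrite !mxE mulr_suml; apply: eq_bigr => i.
  move=> /andP[_ /eqP ic]; rewrite mulr_sumr; apply: eq_bigl => j.
  by rewrite -fiber_rank_eq ic [_ == c :> nat]eq_sym.
rewrite (exchange_big_dep (fun i : multi_index d => i n == a)) /=; last first.
  by move=> c i _ /andP[].
apply: eq_bigr => i ia.
rewrite (big_pred1 (Ordinal (fiber_rank_bound n i))) // => c.
by rewrite ia /= -val_eqE /= eq_sym.
Qed.

(** If no fiber contains two nonzero entries, every cross product in the Gram matrix vanishes. *)
Lemma unfolding_gram_diag (R : realType) (N : nat) (d : 'I_N -> nat) (n : 'I_N)
    (Y : tensor R d) :
  (forall i j, Y i != 0 -> Y j != 0 -> agree_off n i j -> i = j) ->
  forall a b, (unfolding n Y *m (unfolding n Y)^T) a b =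
              if a == b then \sum_(i : multi_index d | i n == a) Y i ^+ 2 else 0.
Proof.
move=> Ysep a b; rewrite unfolding_gram.
have Y0 i j : agree_off n i j -> i <> j -> Y i * Y j = 0.
  move=> ij neq_ij; apply/eqP; rewrite mulf_eq0.
  by apply: contra_notT neq_ij => /norP[Yi Yj]; exact: Ysep.
case: eqP => [<-|neq_ab].
  apply: eq_bigr => i ia; rewrite (bigD1 i) /= ?ia => [|]; last first.
    by apply/forallP => m; apply/implyP.
  rewrite big1 ?addr0 // => j /andP[/andP[_ ij] /eqP ji].
  by apply: Y0 => // E; apply: ji.
rewrite big1 // => i /eqP ia; rewrite big1 // => j /andP[/eqP jb ij].
by apply: Y0 => // E; apply: neq_ab; rewrite -ia -jb E.
Qed.

(** * Leading singular vectors when the Gram matrix is diagonal *)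

Lemma gram_castmx (R : realType) (m m' p : nat) (e : m = m') (M : 'M[R]_(m, p)) :
  castmx (e, erefl) M *m (castmx (e, erefl) M)^T = castmx (e, e) (M *m M^T).
Proof. by case: m' / e. Qed.

(* [i] and [i'] may exceed the width of [D], where [D *m D^T] vanishes. *)
Lemma is_svd_sq_decreasing (R : realType) (m p : nat) (M : 'M[R]_(m, p))
    (U : 'M[R]_m) (D : 'M[R]_(m, p)) (V : 'M[R]_p) (i i' : 'I_m) :
  is_svd M U D V -> (i <= i')%N -> (D *m D^T) i' i' <= (D *m D^T) i i.
Proof.
move=> [_ _ _ Dd [D0 Ddec]] le_ii'; rewrite !mxE.
have DE (k : 'I_m) : \sum_j D k j * D^T j k =
    if insub (val k) is Some j then D k j ^+ 2 else 0.
  case: insubP => [j _ jk|]; last first.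
    rewrite -leqNgt => pk; rewrite big1 // => j _; rewrite Dd ?mul0r //.
    by rewrite gtn_eqF // (leq_trans _ pk).
  rewrite (bigD1 j) //= mxE big1 ?addr0 ?expr2 // => j' neq_j; rewrite Dd ?mul0r //.
  by apply: contra neq_j; rewrite -jk eq_sym => /eqP/val_inj ->.
rewrite !DE; case: insubP => [j' _ jk'|_]; last by case: insubP => // j _ _; exact: sqr_ge0.
case: insubP => [j _ jk|]; last first.
  by rewrite -leqNgt => /leq_trans /(_ le_ii'); rewrite -jk' leqNgt ltn_ord.
rewrite ler_sqr ?nnegrE; first exact: Ddec.
all: exact: D0.
Qed.

(** The columns are the basis vectors other than the one of [l], in an order left free, since equal
    singular values do not determine it. *)
Definition drops_label (R : realType) (m : nat) (A : 'M[R]_(m.+1, m)) (l : 'I_m.+1) :=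
  exists f : 'I_m -> 'I_m.+1,
    [/\ forall a j, A a j = (a == f j)%:R, injective f,
        forall j, f j != l & forall k, k != l -> exists j, f j = k].

(** Here [U] is a permutation matrix, and it lists the diagonal of the Gram matrix in decreasing
    order. The strict minimum, at [l], comes last, and this last column is the one truncated. *)
Lemma leading_left_vectors_drop (R : realType) (svd : svd_routine R)
    (hsvd : is_svd_routine svd) (m p : nat) (hr : (m <= m.+1)%N)
    (M : 'M[R]_(m.+1, p)) (l : 'I_m.+1) :
  is_diag_mx (M *m M^T) ->
  (forall k, k != l -> (M *m M^T) l l < (M *m M^T) k k) ->
  drops_label (leading_left_vectors svd hr M) l.
Proof.
move=> Mdiag lmin; rewrite /leading_left_vectors.
have := hsvd _ _ M; case: (svd m.+1 p M) => [[U D] V] /= [Usvd Ucol].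
have /fin_all_exists [f fE] := Ucol Mdiag.
have UE a j : U a j = (a == f j)%:R.
  by have := congr1 (fun A : 'cV_m.+1 => A a 0) (fE j); rewrite !mxE eqxx andbT.
have [UU VV ME _ _] := Usvd.
have f_inj : injective f.
  (* Two equal basis columns would have inner product 1, against orthonormality. *)
  move=> j j' ff; have := congr1 (fun A : 'M_m.+1 => A j j') UU.
  rewrite !mxE (bigD1 (f j)) //= big1 => [|a /negPf neq_a]; last first.
    by rewrite mxE UE neq_a mul0r.
  rewrite mxE !UE ff eqxx mulr1 addr0 => /eqP E1; apply/eqP.
  by move: E1; case: (j == j') => //; rewrite oner_eq0.
have [g gf fg] := injF_bij f_inj.
have GE j : (M *m M^T) (f j) (f j) = (D *m D^T) j j.
  have <- : U^T *m (M *m M^T) *m U = D *m D^T.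
    rewrite ME !trmx_mul trmxK !mulmxA UU mul1mx -!mulmxA UU mulmx1.
    by rewrite [V^T *m _]mulmxA VV mul1mx.
  rewrite [RHS]mxE (bigD1 (f j)) //= big1 => [|a /negPf neq_a]; last first.
    by rewrite UE neq_a mulr0.
  rewrite addr0 UE eqxx mulr1 [RHS]mxE (bigD1 (f j)) //= big1 ?addr0 => [|a /negPf neq_a].
    by rewrite [U^T _ _]mxE UE eqxx mul1r.
  by rewrite [U^T _ _]mxE UE neq_a mul0r.
(* Otherwise the last column would have strictly more energy than the earlier column of [l]. *)
have gl : g l = ord_max.
  apply/eqP/negPn/negP => gl.
  have /lmin : f ord_max != l by apply: contra gl => /eqP <-; rewrite gf.
  by rewrite -[l in X in X < _]fg !GE ltNge (is_svd_sq_decreasing Usvd) ?leq_ord.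
exists (fun j => f (widen_ord hr j)); split => [a j|j j'|j|k kl].
- by rewrite mxE UE.
- by move/f_inj/(congr1 val) => /= /val_inj.
- apply/negP => /eqP/(congr1 g); rewrite gf gl => /(congr1 val) /= E.
  by have := ltn_ord j; rewrite E ltnn.
- have lt_gk : (g k < m)%N.
    rewrite ltn_neqAle -ltnS ltn_ord andbT; apply: contra kl => /eqP E.
    by apply/eqP/(can_inj fg); rewrite gl; apply: val_inj.
  by exists (Ordinal lt_gk); rewrite -[RHS]fg; congr f; apply: val_inj.
Qed.

(** * Lower bounds for the error from vectors that annihilate the approximation *)

Lemma ler_sum_inj (R : realType) (S T : finType) (h : S -> T) (F : T -> R) :
  injective h -> (forall t, 0 <= F t) -> \sum_s F (h s) <= \sum_t F t.
Proof.
move=> h_inj F0; rewrite [leRHS](bigID (mem (h @: setT))) /=.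
rewrite [X in X + _]big_imset /=; last by move=> x y _ _; exact: h_inj.
rewrite [X in _ <= X + _](eq_bigl xpredT) => [|s]; last by rewrite inE.
by rewrite lerDl sumr_ge0.
Qed.

(** Pythagoras for the component of [x] along the unit vector [u] and the remainder. *)
Lemma sum_sqr_unit_split (R : realType) (T : finType) (u x : T -> R) :
  \sum_t u t ^+ 2 = 1 ->
  \sum_t x t ^+ 2 = (\sum_t u t * x t) ^+ 2 +
                    \sum_t (x t - u t * \sum_s u s * x s) ^+ 2.
Proof.
(* The inner product is made opaque, so that distributing scalars over sums does not enter it. *)
move=> u1; have [w wE] : {w | \sum_t u t * x t = w} by eexists.
rewrite wE.
transitivity (w ^+ 2 + (\sum_t x t ^+ 2 - 2 * w * (\sum_t u t * x t)
                         + w ^+ 2 * (\sum_t u t ^+ 2))).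
  by rewrite u1 wE; ring.
congr (_ + _); rewrite !mulr_sumr -sumrB -big_split /=.
by apply: eq_bigr => t _; ring.
Qed.

(** For unit vectors, this is the squared norm of what [X] loses when projected off [u] on one side
    and off [v] on the other. *)
Definition two_sided_loss (R : realType) (S T : finType) (u : S -> R) (v : T -> R)
    (X : S -> T -> R) : R :=
  \sum_b (\sum_a u a * X a b) ^+ 2 + \sum_a (\sum_b v b * X a b) ^+ 2
  - (\sum_a u a * \sum_b v b * X a b) ^+ 2.

(** The columns of [E] are split along [u], then the rows of the remainder along [v], of which only
    the [v] components are kept. These form [X v] projected off [u], of squared norm
    [|X v|^2 - (u X v)^2]. *)
Lemma two_sided_loss_le (R : realType) (S T : finType) (u : S -> R) (v : T -> R)
    (X E : S -> T -> R) :
  \sum_a u a ^+ 2 = 1 -> \sum_b v b ^+ 2 = 1 ->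
  (forall b, \sum_a u a * E a b = \sum_a u a * X a b) ->
  (forall a, \sum_b v b * E a b = \sum_b v b * X a b) ->
  two_sided_loss u v X <= \sum_a \sum_b E a b ^+ 2.
Proof.
move=> u1 v1 uE vE; rewrite exchange_big /=.
under eq_bigr => b _ do rewrite (sum_sqr_unit_split _ u1) uE.
rewrite big_split /= /two_sided_loss -addrA lerD2l exchange_big /=.
rewrite lerBlDl (sum_sqr_unit_split _ u1) lerD2l.
apply: ler_sum => a _; rewrite [leRHS](sum_sqr_unit_split _ v1).
rewrite -[leLHS]addr0 lerD ?sumr_ge0 // => [|b _]; last exact: sqr_ge0.
rewrite le_eqVlt; apply/orP; left; apply/eqP; congr (_ ^+ 2).
under [RHS]eq_bigr do rewrite mulrBr.
rewrite sumrB vE; congr (_ - _).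
under eq_bigr => a' _ do rewrite mulr_sumr.
rewrite exchange_big mulr_sumr /=; apply: eq_bigr => b _.
by rewrite !mulr_sumr; apply: eq_bigr => a' _; ring.
Qed.

(** A matrix with more rows than columns has a nonzero left kernel, and a vector of it can be
    normalized. *)
Lemma left_kernel_unit (R : realType) (m : nat) (A : 'M[R]_(m.+1, m)) :
  exists2 u : 'rV[R]_m.+1, u *m A = 0 & \sum_a u 0 a ^+ 2 = 1.
Proof.
have /rowV0Pn [v /sub_kermxP vA v0] : kermx A != 0.
  rewrite kermx_eq0 /row_free neq_ltn (leq_ltn_trans (rank_leq_col A)) //.
have s_ge0 : 0 <= \sum_a v 0 a ^+ 2 by apply: sumr_ge0 => a _; exact: sqr_ge0.
have s_neq0 : \sum_a v 0 a ^+ 2 != 0.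
  apply: contra v0; rewrite psumr_eq0 => [/allP v0|a _]; last exact: sqr_ge0.
  apply/eqP/rowP => a; rewrite mxE; apply/eqP.
  by rewrite -sqrf_eq0 (implyP (v0 a (mem_index_enum a))).
exists ((Num.sqrt (\sum_a v 0 a ^+ 2))^-1 *: v).
  by rewrite -scalemxAl vA scaler0.
under eq_bigr do rewrite mxE exprMn.
by rewrite -mulr_sumr exprVn sqr_sqrtr // mulVf.
Qed.

(** Summing along the mode-[n] line [h] produces an entry of [u *m A n] in each term of the
    expansion. *)
Lemma multi_prod_contract (R : realType) (N : nat) (I J : 'I_N -> nat)
    (G : tensor R J) (A : forall n : 'I_N, 'M[R]_(I n, J n)) (n : 'I_N)
    (u : 'rV[R]_(I n)) (i : multi_index I) (h : 'I_(I n) -> multi_index I) :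
  u *m A n = 0 -> (forall a, h a n = a) -> (forall a m, m != n -> h a m = i m) ->
  \sum_a u 0 a * multi_prod G A (h a) = 0.
Proof.
move=> uA hn hm; under eq_bigr do rewrite multi_prodE mulr_sumr.
rewrite exchange_big big1 //= => j _.
transitivity (G j * \prod_(m < N | m != n) A m (i m) (j m) * (u *m A n) 0 (j n)).
  rewrite mxE mulr_sumr; apply: eq_bigr => a _.
  rewrite (bigD1 n) //= hn (eq_bigr (fun m => A m (i m) (j m))); last first.
    by move=> m mn; rewrite hm.
  by ring.
by rewrite uA mxE mulr0.
Qed.

Lemma tensorBE (R : realType) (N : nat) (d : 'I_N -> nat) (X Y : tensor R d)
    (i : multi_index d) : (X - Y) i = X i - Y i.
Proof. by rewrite !ffunE. Qed.

(** * The tensor, its support, and an approximation with error 1 *)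

Lemma exists_third (N : nat) (hN : (3 <= N)%N) (n b : 'I_N) :
  exists2 m, m != n & m != b.
Proof.
have : (0 < #|~: [set n; b]|)%N.
  rewrite cardsCs setCK card_ord subn_gt0 (leq_trans _ hN) // cards2.
  by case: (n != b).
by case/card_gt0P => m; rewrite !inE negb_or => /andP[]; exists m.
Qed.

Definition point (N : nat) (n : 'I_N) (x y : nat) (m : 'I_N) : nat :=
  if m == n then x else y.

(* The best approximation drops label 0 in every mode.  Label 1 is the cheapest one in each
   mode separately, so the sequential truncation drops it, at a fresh cost [c ^+ 2] per
   mode.  The entries [4] keep labels 2 and 3 expensive throughout. *)
Definition bad_entry (R : realType) (c : R) (N : nat) (f : 'I_N -> nat) : R :=
  if [forall m, f m == 0%N] then 1
  else if [exists n, [forall m, f m == point n 1 2 m]] then c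
  else if [exists n, [forall m, f m == point n 2 3 m]] then 4
  else 0.

Definition bad_tensor (R : realType) (c : R) (N : nat) :
    tensor R (fun _ : 'I_N => 4%N) :=
  [ffun i : multi_index (fun _ : 'I_N => 4%N) => bad_entry c (fun m => i m)].

Lemma bad_tensorE (R : realType) (c : R) (N : nat)
    (i : multi_index (fun _ : 'I_N => 4%N)) :
  bad_tensor c N i = bad_entry c (fun m => i m).
Proof. by rewrite ffunE. Qed.

Lemma eq_bad_entry (R : realType) (c : R) (N : nat) (f g : 'I_N -> nat) :
  f =1 g -> bad_entry c f = bad_entry c g.
Proof.
move=> fg; rewrite /bad_entry (eq_forallb (fun m => congr1 (eq_op^~ _) (fg m))).
by do 2![rewrite (eq_existsb (fun n =>
  eq_forallb (fun m => congr1 (eq_op^~ _) (fg m))))].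
Qed.

Variant bad_entry_spec (R : realType) (c : R) (N : nat) (f : 'I_N -> nat) : R -> Prop :=
| BadOne of (forall m, f m = 0%N) : bad_entry_spec c f 1
| BadSmall n of f =1 point n 1 2 : bad_entry_spec c f c
| BadHeavy n of f =1 point n 2 3 : bad_entry_spec c f 4
| BadZero : bad_entry_spec c f 0.

Lemma bad_entryP (R : realType) (c : R) (N : nat) (f : 'I_N -> nat) :
  bad_entry_spec c f (bad_entry c f).
Proof.
rewrite /bad_entry; case: forallP => [f0|_]; first by apply: BadOne => m; exact/eqP.
case: existsP => [[n /forallP fn]|_]; first by apply: (BadSmall c (n := n)) => m; exact/eqP.
case: existsP => [[n /forallP fn]|_]; last exact: BadZero.
by apply: (BadHeavy c (n := n)) => m; exact/eqP.
Qed.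

Lemma bad_entry_one (R : realType) (c : R) (N : nat) (f : 'I_N -> nat) :
  (forall m, f m = 0%N) -> bad_entry c f = 1.
Proof. by move=> f0; rewrite /bad_entry; case: forallP => // -[m]; rewrite f0. Qed.

Lemma bad_entry_small (R : realType) (c : R) (N : nat) (f : 'I_N -> nat) (n : 'I_N) :
  f =1 point n 1 2 -> bad_entry c f = c.
Proof.
move=> fn; rewrite /bad_entry; case: forallP => [/(_ n)|_].
  by rewrite fn /point eqxx.
by case: existsP => // -[]; exists n; apply/forallP => m; rewrite fn.
Qed.

Lemma bad_entry_heavy (R : realType) (c : R) (N : nat) (hN : (3 <= N)%N)
    (f : 'I_N -> nat) (n : 'I_N) :
  f =1 point n 2 3 -> bad_entry c f = 4.
Proof.
move=> fn; rewrite /bad_entry; case: forallP => [/(_ n)|_].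
  by rewrite fn /point eqxx.
case: existsP => [[b /forallP fb]|_]; last first.
  by case: existsP => // -[]; exists n; apply/forallP => m; rewrite fn.
(* The test for [c] comes before the one for 4, so it must be refuted: away from [n] the index is 3,
   which [point b 1 2] never takes. *)
have [m /negPf mn _] := exists_third hN n n.
by have := fb m; rewrite fn /point mn; case: ifP.
Qed.

(** For [a != b] the two points differ at both [a] and [b], hence at some mode other than [n]. *)
Lemma point_agree (N : nat) (n a b : 'I_N) (x y : nat) : x != y ->
  (forall m, m != n -> point a x y m = point b x y m) ->
  point a x y n = point b x y n.
Proof.
move=> xy E; have [->//|ab] := eqVneq a b.
have [an|an] := eqVneq a n; last first.
  by have := E a an; rewrite /point eqxx (negPf ab) => /eqP; rewrite (negPf xy).
have bn : b != n by rewrite -an eq_sym.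
have := E b bn; rewrite /point eqxx [b == a]eq_sym (negPf ab) => /esym/eqP.
by rewrite (negPf xy).
Qed.

(* The support of [bad_entry] is a code of minimum distance 2. *)
Lemma bad_entry_sep (R : realType) (c : R) (N : nat) (hN : (3 <= N)%N)
    (f g : 'I_N -> nat) (n : 'I_N) :
  bad_entry c f != 0 -> bad_entry c g != 0 ->
  (forall m, m != n -> f m = g m) -> f n = g n.
Proof.
have small_heavy (a b m : 'I_N) : m != b -> point a 1 2 m <> point b 2 3 m.
  by rewrite /point => /negPf ->; case: eqP.
case: bad_entryP; last by rewrite eqxx.
- move=> f0 _; case: bad_entryP; last by rewrite eqxx.
  + by move=> g0 _ _; rewrite f0 g0.
  + move=> b gb _ fg; have [m mn _] := exists_third hN n n.
    by have := fg m mn; rewrite f0 gb /point; case: eqP.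
  + move=> b gb _ fg; have [m mn _] := exists_third hN n n.
    by have := fg m mn; rewrite f0 gb /point; case: eqP.
- move=> a fa _; case: bad_entryP; last by rewrite eqxx.
  + move=> g0 _ fg; have [m mn _] := exists_third hN n n.
    by have := fg m mn; rewrite g0 fa /point; case: eqP.
  + move=> b gb _ fg; rewrite fa gb; apply: point_agree => // m mn.
    by rewrite -fa -gb fg.
  (* Mode [m] has to avoid [b] as well as [n]: at [b] the heavy point has index 2, which it may
     share with a small point. This takes three modes. *)
  + move=> b gb _ fg; have [m mn mb] := exists_third hN n b.
    by have := fg m mn; rewrite fa gb => /small_heavy; case.
- move=> a fa _; case: bad_entryP; last by rewrite eqxx.
  + move=> g0 _ fg; have [m mn _] := exists_third hN n n.
    by have := fg m mn; rewrite g0 fa /point; case: eqP.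
  + move=> b gb _ fg; have [m mn mb] := exists_third hN n a.
    by have := fg m mn; rewrite fa gb => /esym/small_heavy; case.
  + move=> b gb _ fg; rewrite fa gb; apply: point_agree => // m mn.
    by rewrite -fa -gb fg.
Qed.

(** The factors include the labels 1, 2, 3 into all four, and the core is the restriction of the
    tensor to them. Only the entry at [(0, ..., 0)] is lost, as the rest of the support avoids label
    0. *)
Lemma bad_tensor_attains_1 (R : realType) (c : R) (N : nat) (hN : (3 <= N)%N) :
  exists (G : tensor R (fun _ : 'I_N => 3%N)) (A : forall n : 'I_N, 'M[R]_(4, 3)),
    frob_sq (bad_tensor c N - multi_prod G A) = 1.
Proof.
pose I := fun _ : 'I_N => 4%N; pose r := fun _ : 'I_N => 3%N.
pose up (j : multi_index r) : multi_index I := [ffun m => lift ord0 (j m)].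
exists [ffun j : multi_index r => bad_tensor c N (up j)].
exists (fun _ => \matrix_(a, j) (a == lift ord0 j)%:R).
set T := multi_prod _ _.
have TE i : T i = if [forall m, i m != ord0] then bad_tensor c N i else 0.
  rewrite /T multi_prodE.
  case: forallP => [i0|/forallP]; last first.
    rewrite negb_forall => /existsP[m]; rewrite negbK => /eqP im.
    by rewrite big1 // => j _; rewrite (bigD1 m) //= mxE im mul0r mulr0.
  have [|j jE] := @multi_index_of_nat N r (fun m => (i m).-1).
    by move=> m; have := i0 m; case: (i m) => -[].
  have jE' m : i m = lift ord0 (j m).
    by apply: val_inj; rewrite /= /bump /= jE add1n prednK // lt0n; exact: i0.
  rewrite (bigD1 j) //= big1 ?mulr1 => [|m _]; last by rewrite mxE -jE' eqxx.
  rewrite big1 ?addr0 => [|j' jj']; last first.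
    have [m jm] : exists m, j' m != j m.
      apply/existsP; rewrite -negb_forall; apply: contra jj' => /forallP jj'.
      by apply/eqP; apply: multi_index_ext => m; have /eqP -> := jj' m.
    rewrite (bigD1 m) //= mxE jE' (inj_eq lift_inj) eq_sym (negPf jm).
    by rewrite mul0r mulr0.
  by rewrite ffunE; congr (bad_tensor c N _); apply/ffunP => m; rewrite ffunE jE'.
pose z : multi_index I := [ffun m => ord0].
have n0 : 'I_N by case: N hN {T TE I r up z} => // N' _; exact: ord0.
rewrite /frob_sq (bigD1 z) //= big1 => [|i iz].
  rewrite addr0 tensorBE TE bad_tensorE bad_entry_one => [|m]; last by rewrite ffunE.
  case: forallP => [/(_ n0)|_]; first by rewrite ffunE eqxx.
  by rewrite subr0 expr1n.
rewrite tensorBE TE bad_tensorE; case: forallP => [_|/forallP]; first by rewrite subrr expr0n.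
rewrite negb_forall => /existsP[m]; rewrite negbK => /eqP im; rewrite subr0.
case: bad_entryP => [i0|n in0|n in0|]; last by rewrite expr0n.
- by case/eqP: iz; apply/ffunP => k; apply: val_inj; rewrite /= i0 ffunE.
- by have := in0 m; rewrite im /point; case: eqP.
- by have := in0 m; rewrite im /point; case: eqP.
Qed.

(** * Inequalities for the three 4 by 4 slices *)

Definition slice_one (R : realType) (a b : nat) : R :=
  if (a == 0)%N && (b == 0)%N then 1 else 0.

(** The entry [g] at [(3, 3)] depends on the order: it is 4 for three modes and 0 for more. Keeping
    it arbitrary treats all [N] at once. *)
Definition slice_small (R : realType) (c g : R) (a b : nat) : R :=
  if (a == 1)%N && (b == 2)%N || (a == 2)%N && (b == 1)%N then c
  else if (a == 3)%N && (b == 3)%N then g else 0.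

Definition slice_heavy (R : realType) (a b : nat) : R :=
  if (a == 2)%N && (b == 3)%N || (a == 3)%N && (b == 2)%N then 4 else 0.

(** The difference of the two sides is an explicit sum of nonnegative terms for every [g]. The
    negative multiples of [u2 ^+ 2] and [v2 ^+ 2] are to be paid for by the heavy slice. *)
Lemma slice_small_ineq (R : realType) (c g u1 u2 u3 v1 v2 v3 : R) :
  u1 ^+ 2 <= 1 -> u3 ^+ 2 <= 1 -> v1 ^+ 2 <= 1 -> v3 ^+ 2 <= 1 ->
  c ^+ 2 * (u1 ^+ 2 + v1 ^+ 2 - 3 * u2 ^+ 2 - 3 * v2 ^+ 2) <=
  (u2 * c) ^+ 2 + (u1 * c) ^+ 2 + (u3 * g) ^+ 2 +
  ((v2 * c) ^+ 2 + (v1 * c) ^+ 2 + (v3 * g) ^+ 2) -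
  (u1 * (v2 * c) + u2 * (v1 * c) + u3 * (v3 * g)) ^+ 2.
Proof.
move=> hu1 hu3 hv1 hv3; rewrite -subr_ge0.
set F := (X in 0 <= X).
have -> : F = (c * (u1 * v2 + u2 * v1) - g * u3 * v3) ^+ 2
  + 2 * (c * (u1 * v2 - u2 * v1)) ^+ 2
  + 4 * ((c * v2) ^+ 2 * (1 - u1 ^+ 2) + (c * u2) ^+ 2 * (1 - v1 ^+ 2))
  + ((u3 * g) ^+ 2 * (1 - v3 ^+ 2) + (v3 * g) ^+ 2 * (1 - u3 ^+ 2)).
  by rewrite /F; ring.
by do ?[exact: ler0n | exact: sqr_ge0 | rewrite subr_ge0 | apply: addr_ge0 | apply: mulr_ge0].
Qed.

(** Put [P = u2^2 + u3^2] and [Q = v2^2 + v3^2]. By Cauchy-Schwarz the subtracted square is at most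
    [16 P Q], and [2 P Q <= P + Q] because both are at most 1. *)
Lemma slice_heavy_ineq (R : realType) (u2 u3 v2 v3 : R) :
  u2 ^+ 2 + u3 ^+ 2 <= 1 -> v2 ^+ 2 + v3 ^+ 2 <= 1 ->
  8 * (u2 ^+ 2 + u3 ^+ 2 + v2 ^+ 2 + v3 ^+ 2) <=
  (u3 * 4) ^+ 2 + (u2 * 4) ^+ 2 + ((v3 * 4) ^+ 2 + (v2 * 4) ^+ 2)
  - (u2 * (v3 * 4) + u3 * (v2 * 4)) ^+ 2.
Proof.
move=> hu hv; rewrite -subr_ge0; set F := (X in 0 <= X).
have -> : F = 16 * (u2 * v2 - u3 * v3) ^+ 2
  + 8 * ((u2 ^+ 2 + u3 ^+ 2) * (1 - (v2 ^+ 2 + v3 ^+ 2))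
       + (v2 ^+ 2 + v3 ^+ 2) * (1 - (u2 ^+ 2 + u3 ^+ 2))).
  by rewrite /F; ring.
by do ?[exact: ler0n | exact: sqr_ge0 | rewrite subr_ge0 | apply: addr_ge0 | apply: mulr_ge0].
Qed.

(** After [u1] and [v1] are eliminated by normalization, the heavy slice absorbs all terms in labels
    2 and 3. With [c^2 >= 1/2] there remains at least [1 + (u0^2 + v0^2) / 2 - u0^2 v0^2], which is
    at least 1. *)
Lemma slices_loss_ge1 (R : realType) (c g : R) (u v : 'I_4 -> R) :
  \sum_a u a ^+ 2 = 1 -> \sum_b v b ^+ 2 = 1 -> 1 / 2 <= c ^+ 2 -> c ^+ 2 <= 1 ->
  1 <= two_sided_loss u v (fun a b => slice_one R a b)
       + two_sided_loss u v (fun a b => slice_small c g a b)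
       + two_sided_loss u v (fun a b => slice_heavy R a b).
Proof.
rewrite /two_sided_loss !big_ord_recl !big_ord0 /slice_one /slice_small /slice_heavy /=.
set u0 := u _; set u1 := u _; set u2 := u _; set u3 := u _.
set v0 := v _; set v1 := v _; set v2 := v _; set v3 := v _.
rewrite !mulr0 !addr0 !add0r !mulr1 !mulr0 !addr0 !add0r => hu hv hc hc1.
have [u00 u10 u20 u30] : [/\ 0 <= u0 ^+ 2, 0 <= u1 ^+ 2, 0 <= u2 ^+ 2 & 0 <= u3 ^+ 2].
  by rewrite !sqr_ge0.
have [v00 v10 v20 v30] : [/\ 0 <= v0 ^+ 2, 0 <= v1 ^+ 2, 0 <= v2 ^+ 2 & 0 <= v3 ^+ 2].
  by rewrite !sqr_ge0.
have [hu1 hu3 hv1 hv3] :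
    [/\ u1 ^+ 2 <= 1, u3 ^+ 2 <= 1, v1 ^+ 2 <= 1 & v3 ^+ 2 <= 1] by split; lra.
have hu23 : u2 ^+ 2 + u3 ^+ 2 <= 1 by lra.
have hv23 : v2 ^+ 2 + v3 ^+ 2 <= 1 by lra.
have small := slice_small_ineq c g u2 v2 hu1 hu3 hv1 hv3.
have heavy := slice_heavy_ineq hu23 hv23.
(* The remaining facts supply the products that linear arithmetic cannot form by itself. *)
have uE : c ^+ 2 * u1 ^+ 2 = c ^+ 2 * (1 - u0 ^+ 2 - u2 ^+ 2 - u3 ^+ 2).
  by congr (_ * _); lra.
have vE : c ^+ 2 * v1 ^+ 2 = c ^+ 2 * (1 - v0 ^+ 2 - v2 ^+ 2 - v3 ^+ 2).
  by congr (_ * _); lra.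
have p1 : 0 <= u0 ^+ 2 * (1 - v0 ^+ 2) + v0 ^+ 2 * (1 - u0 ^+ 2).
  by rewrite addr_ge0 // mulr_ge0 //; lra.
have p2 : 0 <= (c ^+ 2 - 1 / 2) * (2 - u0 ^+ 2 - v0 ^+ 2).
  by rewrite mulr_ge0 //; lra.
have p3 : 0 <= (1 - c ^+ 2) *
    (4 * u2 ^+ 2 + 4 * v2 ^+ 2 + u3 ^+ 2 + v3 ^+ 2).
  by rewrite mulr_ge0 //; lra.
lra.
Qed.

(** * The slices inside the tensor, and the optimality of error 1 *)

Definition plane (N : nat) (n0 n1 : 'I_N) (a b k : 'I_4) :
    multi_index (fun _ : 'I_N => 4%N) :=
  [ffun m => if m == n0 then a else if m == n1 then b else k].

Section Plane.
Variables (R : realType) (c : R) (N : nat) (hN : (3 <= N)%N).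
Variables (n0 n1 : 'I_N) (n01 : n0 != n1).

Let X a b k := bad_tensor c N (plane n0 n1 a b k).

Lemma planeE0 a b k : plane n0 n1 a b k n0 = a.
Proof. by rewrite ffunE eqxx. Qed.

Lemma planeE1 a b k : plane n0 n1 a b k n1 = b.
Proof. by rewrite ffunE eq_sym (negPf n01) eqxx. Qed.

Lemma planeE a b k m : m != n0 -> m != n1 -> plane n0 n1 a b k m = k.
Proof. by move=> /negPf m0 /negPf m1; rewrite ffunE m0 m1. Qed.

Lemma plane_inj : injective (fun abk => plane n0 n1 abk.1.1 abk.1.2 abk.2).
Proof.
move=> [[a b] k] [[a' b'] k'] /= E.
have [m m0 m1] := exists_third hN n0 n1.
have := congr1 (fun i : multi_index _ => i n0) E; rewrite !planeE0 => ->.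
have := congr1 (fun i : multi_index _ => i n1) E; rewrite !planeE1 => ->.
by have := congr1 (fun i : multi_index _ => i m) E; rewrite !planeE // => ->.
Qed.

(** The distinguished mode [n] is [n0], [n1] or one of the modes carrying [k]. *)
Lemma plane_point n x y a b k : (fun m => plane n0 n1 a b k m : nat) =1 point n x y ->
  [\/ [/\ a = x :> nat, b = y :> nat & k = y :> nat],
      [/\ a = y :> nat, b = x :> nat & k = y :> nat]
    | [/\ a = y :> nat, b = y :> nat & k = x :> nat]].
Proof.
move=> E; have [m m0 m1] := exists_third hN n0 n1.
have := E n0; have := E n1; have := E m; rewrite planeE0 planeE1 planeE // /point.
have [<-|n0n] := eqVneq n0 n.
  by rewrite [n1 == n0]eq_sym (negPf n01) (negPf m0) => -> -> ->; constructor 1.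
have [<-|n1n] := eqVneq n1 n.
  by rewrite (negPf m1) => -> -> ->; constructor 2.
have := E n; rewrite planeE 1?eq_sym // /point eqxx => -> _ -> ->.
by constructor 3.
Qed.

Lemma plane_zero a b k : (forall m, plane n0 n1 a b k m = 0%N :> nat) ->
  [/\ a = 0%N :> nat, b = 0%N :> nat & k = 0%N :> nat].
Proof.
move=> E; have [m m0 m1] := exists_third hN n0 n1.
by have := E n0; have := E n1; have := E m; rewrite planeE0 planeE1 planeE.
Qed.

Lemma bad_tensor_slice_one a b (k : 'I_4) : k = 0%N :> nat -> X a b k = slice_one R a b.
Proof.
move=> k0; rewrite /X bad_tensorE /slice_one.
case: ifP => [/andP[/eqP a0 /eqP b0]|ab].
  by rewrite bad_entry_one // => m; rewrite ffunE; do 2?case: ifP.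
case: bad_entryP => [/plane_zero[a0 b0 _]|n /plane_point[] []|n /plane_point[] []|//].
- by rewrite a0 b0 in ab.
all: by rewrite k0.
Qed.

Lemma bad_tensor_slice_small a b (k : 'I_4) : k = 2%N :> nat ->
  X a b k = slice_small c (X ord_max ord_max k) a b.
Proof.
move=> k2; rewrite /slice_small.
case: ifP => [/orP[] /andP[/eqP a0 /eqP b0]|ab].
- rewrite /X bad_tensorE (bad_entry_small c (n := n0)) // => m.
  by rewrite ffunE /point; do 2?case: ifP.
- rewrite /X bad_tensorE (bad_entry_small c (n := n1)) // => m.
  rewrite ffunE /point; have [->|_] := eqVneq m n0; last by case: ifP.
  by rewrite (negPf n01).
case: ifP => [/andP[/eqP a3 /eqP b3]|ab3].
  by congr X; apply: val_inj.
rewrite /X bad_tensorE.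
case: bad_entryP => [/plane_zero[_ _]|n /plane_point[] []|n /plane_point[] []|//].
all: rewrite k2 // => a0 b0.
all: by move: ab ab3; rewrite a0 b0.
Qed.

Lemma bad_tensor_slice_heavy a b (k : 'I_4) : k = 3%N :> nat ->
  X a b k = slice_heavy R a b.
Proof.
move=> k3; rewrite /X bad_tensorE /slice_heavy.
case: ifP => [/orP[] /andP[/eqP a0 /eqP b0]|ab].
- rewrite (bad_entry_heavy c hN (n := n0)) // => m.
  by rewrite ffunE /point; do 2?case: ifP.
- rewrite (bad_entry_heavy c hN (n := n1)) // => m.
  rewrite ffunE /point; have [->|_] := eqVneq m n0; last by case: ifP.
  by rewrite (negPf n01).
case: bad_entryP => [/plane_zero[_ _]|n /plane_point[] []|n /plane_point[] []|//].
all: rewrite k3 // => a0 b0.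
all: by move: ab; rewrite a0 b0.
Qed.

End Plane.

Lemma bad_tensor_error_ge1 (R : realType) (c : R) (N : nat) (hN : (3 <= N)%N)
    (G : tensor R (fun _ : 'I_N => 3%N)) (A : forall n : 'I_N, 'M[R]_(4, 3)) :
  1 / 2 <= c ^+ 2 -> c ^+ 2 <= 1 -> 1 <= frob_sq (bad_tensor c N - multi_prod G A).
Proof.
move=> hc hc1; pose n0 := Ordinal (ltn_trans (isT : 0 < 2)%N hN).
pose n1 := Ordinal (ltn_trans (isT : 1 < 2)%N hN).
have n01 : n0 != n1 by [].
have [u uA u1] := left_kernel_unit (A n0); have [v vA v1] := left_kernel_unit (A n1).
pose X k a b := bad_tensor c N (plane n0 n1 a b k).
pose E k a b := (bad_tensor c N - multi_prod G A) (plane n0 n1 a b k).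
have uE k b : \sum_a u 0 a * E k a b = \sum_a u 0 a * X k a b.
  rewrite /E; under eq_bigr do rewrite tensorBE mulrBr.
  (* The base index is filled with [b] in mode [n0] too, where the line overrides it. *)
  rewrite sumrB [X in _ - X](@multi_prod_contract _ _ _ _ _ _ n0 u (plane n0 n1 b b k)) ?subr0 //.
    by move=> a; rewrite planeE0.
  by move=> a m /negPf m0; rewrite !ffunE m0.
have vE k a : \sum_b v 0 b * E k a b = \sum_b v 0 b * X k a b.
  rewrite /E; under eq_bigr do rewrite tensorBE mulrBr.
  rewrite sumrB [X in _ - X](@multi_prod_contract _ _ _ _ _ _ n1 v (plane n0 n1 a a k)) ?subr0 //.
    by move=> b; rewrite planeE1.
  by move=> b m /negPf m1; rewrite !ffunE m1.
pose k0 : 'I_4 := inord 0; pose k2 : 'I_4 := inord 2; pose k3 : 'I_4 := inord 3.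
apply: le_trans (slices_loss_ge1 (X k2 ord_max ord_max) u1 v1 hc hc1) _.
have lossE k h : (forall a b, X k a b = h a b) ->
    two_sided_loss (u 0) (v 0) h <= \sum_a \sum_b E k a b ^+ 2.
  move=> Xh; apply: two_sided_loss_le => // [b|a].
    by rewrite uE; apply: eq_bigr => a _; rewrite Xh.
  by rewrite vE; apply: eq_bigr => b _; rewrite Xh.
apply: (@le_trans _ _ (\sum_k \sum_a \sum_b E k a b ^+ 2)); last first.
  (* Distinct triples give distinct positions, so the slices together form a part of the Frobenius
     norm. *)
  have := ler_sum_inj (F := fun i => (bad_tensor c N - multi_prod G A) i ^+ 2)
    (plane_inj hN n01) (fun _ => sqr_ge0 _).
  apply: le_trans; rewrite exchange_big.
  under eq_bigr do rewrite exchange_big /=.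
  by rewrite !pair_big /=.
have sq k : 0 <= \sum_a \sum_b E k a b ^+ 2.
  by apply: sumr_ge0 => a _; apply: sumr_ge0 => b _; exact: sqr_ge0.
have l0 := lossE k0 _ (fun a b => bad_tensor_slice_one c hN n01 a b (inordK (isT : 0 < 4)%N)).
have l2 := lossE k2 _ (fun a b => bad_tensor_slice_small c hN n01 a b (inordK (isT : 2 < 4)%N)).
have l3 := lossE k3 _ (fun a b => bad_tensor_slice_heavy c hN n01 a b (inordK (isT : 3 < 4)%N)).
have neq (x y : nat) : (x < 4)%N -> (y < 4)%N -> x != y -> inord x != inord y :> 'I_4.
  by move=> hx hy; apply: contra => /eqP/(congr1 val); rewrite /= !inordK // => ->.
have three (S : 'I_4 -> R) : (forall k, 0 <= S k) -> S k0 + S k2 + S k3 <= \sum_k S k.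
  move=> S0; rewrite (bigD1 k0) // (bigD1 k2) /=; last exact: neq.
  rewrite (bigD1 k3) /=; last by apply/andP; split; exact: neq.
  by rewrite !addrA lerDl sumr_ge0.
by apply: le_trans (three _ sq); rewrite !lerD.
Qed.

(** * The sequential truncation drops label 1 in every mode *)

Section SequentialTruncation.
Variables (R : realType) (svd : svd_routine R) (hsvd : is_svd_routine svd).
Variables (c : R) (hc1 : c ^+ 2 < 1) (N : nat) (hN : (3 <= N)%N).

Let I := fun _ : 'I_N => 4%N.
Let r := fun _ : 'I_N => 3%N.
Variable hr : forall n, (r n <= I n)%N.

(** By strong induction the earlier factors only remove label 1, so the iterate is the original
    tensor relabelled on the remaining positions. Its mode-[n] Gram matrix is still diagonal. Label
    1 has energy [c ^+ 2 < 1], since its entry has label 2 in all other modes and survives, and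
    every other label keeps an entry at least 1. *)
Lemma st_factor_bad_drops (n : 'I_N) :
  @drops_label R 3 (st_factor svd hr (bad_tensor c N) n) (inord 1).
Proof.
have [k] := ubnP (val n); elim: k n => // k IHk n /=; rewrite ltnS => nk.
pose A m : 'M[R]_(4, 3) := st_factor svd hr (bad_tensor c N) m.
(* From mode [n] on, [f] has a dummy value, which [g] below does not read. *)
have /fin_all_exists[f fE] (m : 'I_N) : exists f : 'I_3 -> 'I_4, (m < n)%N ->
    [/\ forall a j, A m a j = (a == f j)%:R, injective f,
        forall j, f j != inord 1 & forall k, k != inord 1 -> exists j, f j = k].
  have [mn|_] := boolP (m < n)%N; last by exists (fun _ => ord0).
  by have [f fP] := IHk m (leq_trans mn nk); exists f.
rewrite /st_factor /st_step_factor.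
set Y := st_iterate _ _ _ _.
(* [g] translates an index of the current iterate into original labels. *)
pose g (i : multi_index (stage I r n)) (m : 'I_N) : nat :=
  if (m < n)%N then val (f m (inord (i m))) else val (i m).
have YE i : Y i = bad_entry c (g i).
  have [|j jE] := @multi_index_of_nat N I (g i).
    move=> m; rewrite /g; case: ifP => [_|mn]; first exact: ltn_ord.
    by have := ltn_ord (i m); rewrite [X in (_ < X)%N]/stage mn.
  rewrite /Y st_iterateE.
  rewrite (@partial_multi_prod_select _ _ _ _ _ _ _ _
    (fun m x => val (f m (inord x))) _ i j) //.
    by rewrite bad_tensorE; apply: eq_bad_entry.
  by move=> m mn a b; have [fA _ _ _] := fE m mn; rewrite mxE -/(A m) fA inord_val.
have gn i : g i n = i n by rewrite /g ltnn.
have g_off i j : agree_off n i j -> forall m, m != n -> g i m = g j m.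
  move=> /forallP ij m mn; rewrite /g.
  by have /eqP /= -> := implyP (ij m) mn.
have lt3 (i : multi_index (stage I r n)) (m : 'I_N) : (m < n)%N -> (i m < 3)%N.
  by move=> mn; have := ltn_ord (i m); rewrite [X in (_ < X)%N]/stage mn.
have g_inj i j : g i =1 g j -> i = j.
  move=> gij; apply: multi_index_ext => m; have := gij m; rewrite /g.
  case: ifP => // mn; have [_ f_inj _ _] := fE m mn.
  by move=> /val_inj/f_inj/(congr1 val); rewrite /= !inordK ?lt3.
(* The surviving positions are those without label 1 in the modes already processed. *)
have g_surj (t : 'I_N -> nat) : (forall m, (t m < 4)%N) ->
    (forall m : 'I_N, (m < n)%N -> t m != 1%N) -> exists i, g i =1 t.
  move=> t4 t1.
  have /fin_all_exists[s sE] (m : 'I_N) : exists s : nat, (s < stage I r n m)%N /\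
      (if (m < n)%N then val (f m (inord s)) else s) = t m.
    rewrite /stage; case: ifP => mn; last by exists (t m).
    have [_ _ _ fs] := fE m mn.
    have [|j fj] := fs (inord (t m)).
      apply: contra (t1 m mn) => /eqP/(congr1 val); rewrite /= !inordK //.
      by move=> ->.
    by exists j; rewrite inord_val fj /= inordK.
  have [i iE] := multi_index_of_nat (fun m => (sE m).1).
  by exists i => m; rewrite /g /= !iE; have [_ <-] := sE m.
have Ysep i j : Y i != 0 -> Y j != 0 -> agree_off n i j -> i = j.
  rewrite !YE => Yi Yj ij; apply: multi_index_ext => m.
  have [->|mn] := eqVneq m n; last exact/eqP/(implyP (forallP ij m)).
  by rewrite -!gn; exact: bad_entry_sep Yi Yj (g_off _ _ ij).
have gramE := unfolding_gram_diag Ysep.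
set M := castmx _ _.
have ME a b : (M *m M^T) a b = if a == b then
    \sum_(i : multi_index (stage I r n) | i n == a :> nat) Y i ^+ 2 else 0.
  rewrite /M gram_castmx castmxE gramE.
  by rewrite (inj_eq (@cast_ord_inj _ _ _)).
have label_ge k' (i : multi_index (stage I r n)) : i n = k' :> nat -> 1 <= Y i ->
    1 <= \sum_(i : multi_index (stage I r n) | i n == k' :> nat) Y i ^+ 2.
  move=> ik Yi; rewrite (bigD1 i) /= ?ik // -[1]addr0 lerD //.
    by rewrite -(expr1n _ 2) lerXn2r ?nnegrE ?ler01 // (le_trans ler01).
  by apply: sumr_ge0 => j _; exact: sqr_ge0.
apply: leading_left_vectors_drop => //.
  by apply/is_diag_mxP => a b ab; rewrite ME -val_eqE (negPf ab).
move=> k' k'1; rewrite !ME !eqxx.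
apply: (@lt_le_trans _ _ 1).
  have [i0 i0E] : exists i, g i =1 point n 1 2.
    apply: g_surj => m; rewrite /point; first by case: eqP.
    by move=> mn; rewrite -val_eqE /= (ltn_eqF mn).
  apply: le_lt_trans hc1; rewrite (bigD1 i0) /=; last first.
    by rewrite -gn i0E /point eqxx inordK.
  rewrite YE (bad_entry_small c i0E) big1 ?addr0 // => i /andP[/eqP i1 ii0].
  rewrite inordK // -gn in i1.
  rewrite YE; case: bad_entryP => [z|b ib|b ib|]; last by rewrite expr0n.
  - by rewrite z in i1.
  - case/eqP: ii0; apply: g_inj => m; rewrite ib i0E.
    by move: i1; rewrite ib /point; case: eqP => // ->.
  - by move: i1; rewrite ib /point; case: eqP.
have k'1n : val k' != 1%N.
  by apply: contra k'1 => /eqP E; apply/eqP; apply: val_inj; rewrite /= inordK.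
have [m mn _] := exists_third hN n n.
have [t tn [t4 t1 tX]] : exists2 t : 'I_N -> nat, t n = k' &
    [/\ forall m, (t m < 4)%N, forall m : 'I_N, (m < n)%N -> t m != 1%N
      & 1 <= bad_entry c t].
  (* Surviving witnesses: the zero position for label 0, the heavy position of [n] for label 2, and
     that of another mode [m] for label 3. *)
  case: k' {k'1} k'1n => -[|[//|[|[|//]]]] /= _ _.
  - by exists (fun _ => 0%N) => //; split=> //; rewrite bad_entry_one.
  - exists (point n 2 3); first by rewrite /point eqxx.
    split=> [a|a _|]; try by rewrite /point; case: ifP.
    by rewrite (bad_entry_heavy c hN (n := n)) // ler1n.
  - exists (point m 2 3); first by rewrite /point eq_sym (negPf mn).
    split=> [a|a _|]; try by rewrite /point; case: ifP.
    by rewrite (bad_entry_heavy c hN (n := m)) // ler1n.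
have [i iE] := g_surj t t4 t1.
apply: (label_ge _ i); first by rewrite -gn iE.
by rewrite YE (eq_bad_entry c iE).
Qed.

(** At the small position of mode [n] the approximation vanishes, because the row of label 1 in the
    factor of mode [n] is zero. The [N] positions are distinct and each costs [c ^+ 2]. *)
Lemma st_hosvd_bad_error :
  N%:R * c ^+ 2 <= frob_sq (bad_tensor c N - st_hosvd svd hr (bad_tensor c N)).
Proof.
pose e (n : 'I_N) : multi_index I := [ffun m => inord (point n 1 2 m)].
have eE n m : e n m = point n 1 2 m :> nat.
  by rewrite ffunE inordK // /point; case: eqP.
have e_inj : injective e.
  move=> n n' /(congr1 (fun i : multi_index I => val (i n))) /=.
  by rewrite !eE /point eqxx; case: eqP.
have := ler_sum_inj (F := fun i =>
  (bad_tensor c N - st_hosvd svd hr (bad_tensor c N)) i ^+ 2) e_inj (fun _ => sqr_ge0 _).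
apply: le_trans; rewrite mulr_natl -[X in _ *+ X]card_ord -sumr_const.
apply: ler_sum => n _; rewrite tensorBE bad_tensorE (bad_entry_small c (eE n)).
rewrite /st_hosvd multi_prodE big1 ?subr0 // => j _.
have [f [fE _ f1 _]] := st_factor_bad_drops n.
have en : e n n = inord 1 by rewrite ffunE /point eqxx.
by rewrite (bigD1 n) //= fE en eq_sym (negPf (f1 _)) mul0r mulr0.
Qed.

End SequentialTruncation.

Theorem mainTheorem2 (R : realType) (svd : svd_routine R)
    (hsvd : is_svd_routine svd) (N : nat) (hN : (3 <= N)%N)
    (eps : R) (heps : 0 < eps) :
  exists (I r : 'I_N -> nat) (hr : forall n, (r n <= I n)%N)
         (X : tensor R I) (L : R),
    [/\ forall n, (0 < r n)%N,
        is_tucker_min r X L,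
        0 < L
      & frob_sq (X - st_hosvd svd hr X) >= N%:R / (1 + eps) * L].
Proof.
(* [c2] is the square of [c]: the bound [(1 + eps)^-1] gives the ratio, and [1 / 2] is what the
   optimality of error 1 asks for. *)
pose c2 : R := Num.max (1 / 2) (1 + eps)^-1.
have e1 : 0 < 1 + eps by rewrite addr_gt0.
have c2_half : 1 / 2 <= c2 by rewrite le_max lexx.
have c2_eps : (1 + eps)^-1 <= c2 by rewrite le_max lexx orbT.
have c2_lt1 : c2 < 1.
  rewrite gt_max invf_lt1 // ltrDl heps andbT; lra.
have c2E : Num.sqrt c2 ^+ 2 = c2 by rewrite sqr_sqrtr //; lra.
have hr (n : 'I_N) : (3 <= 4)%N by [].
exists (fun _ => 4%N), (fun _ => 3%N), hr, (bad_tensor (Num.sqrt c2) N), 1.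
split=> //.
  split; first exact: bad_tensor_attains_1.
  by move=> G A; apply: bad_tensor_error_ge1; rewrite ?c2E // ltW.
apply: le_trans (st_hosvd_bad_error hsvd _ hN hr); rewrite c2E //.
by rewrite mulr1 ler_wpM2l.
Qed.
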